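(* Let $m,M\ge1$ be integers, let $H:\mathbb{R}^{mM}\to\mathbb{R}$ be continuously differentiable, let $\bm J$ be a constant skew-symmetric real $mM\times mM$ matrix, let $\tau>0$, and let $\pi$ be a permutation of $\{1,\dots,m\}$ and $\sigma$ a permutation of $\{1,\dots,M\}$. The dual-partition averaged vector field (DP-AVF) method for the Hamiltonian system $\dot{\bm Y}=\bm J\nabla H(\bm Y)$ preserves the energy: if $\bm Y,\widehat{\bm Y}\in\mathbb{R}^{mM}$ satisfy $$\frac{\widehat{\bm Y}-\bm Y}{\tau}=\bm J\,\overline{\nabla}^{\mathrm{dp}}H(\widehat{\bm Y},\bm Y),$$ then $H(\widehat{\bm Y})=H(\bm Y)$.
   Context: Write $\bm Y=(\bm y_1,\dots,\bm y_m)^\top\in\mathbb{R}^{mM}$ with $\bm y_l=(y_{l,1},\dots,y_{l,M})\in\mathbb{R}^M$, and likewise $\widehat{\bm Y}$ with components $\widehat y_{l,j}$. The permutation $\pi$ gives an ordering of the variables (the paper's $\widetilde l=\pi(l)$) and $\sigma$ an ordering of the grid points (the paper's $\widetilde i=\sigma(i)$). Dual-partition map: for $a\in\{1,\dots,m\}$, $i\in\{1,\dots,M\}$ and $\theta\in[0,1]$ let $\bm W^{a,i}(\theta)\in\mathbb{R}^{mM}$ be the vector whose $(l,j)$ component is - $\widehat y_{l,j}$ if $\pi^{-1}(l)<a$, or if $l=\pi(a)$ and $\sigma^{-1}(j)<i$; - $\theta\widehat y_{l,j}+(1-\theta)y_{l,j}$ if $l=\pi(a)$ and $j=\sigma(i)$;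 - $y_{l,j}$ otherwise (i.e. if $\pi^{-1}(l)>a$, or if $l=\pi(a)$ and $\sigma^{-1}(j)>i$). Then $\overline{\nabla}^{\mathrm{dp}}H(\widehat{\bm Y},\bm Y)\in\mathbb{R}^{mM}$ is the vector whose $(\pi(a),\sigma(i))$ component is $$\Big[\overline{\nabla}^{\mathrm{dp}}H(\widehat{\bm Y},\bm Y)\Big]_{\pi(a),\sigma(i)}=\int_0^1\frac{\partial H}{\partial y_{\pi(a),\sigma(i)}}\big(\bm W^{a,i}(\theta)\big)\,d\theta .$$ The components of $\overline{\nabla}^{\mathrm{dp}}H$ are arranged in the same (natural, unpermuted) order as those of $\bm Y$ when multiplied by $\bm J$. *)

(* Defs.v *)
From HB Require Import structures.
From mathcomp Require Import all_boot all_order all_algebra all_fingroup.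
From mathcomp Require Import all_classical all_reals all_analysis.

Set Implicit Arguments.
Unset Strict Implicit.
Unset Printing Implicit Defensive.

Import Order.TTheory GRing.Theory Num.Theory.
Import numFieldNormedType.Exports.

Local Open Scope classical_set_scope.
Local Open Scope ring_scope.

(* R^{mM} is 'cV[R]_(m * M).  Coordinate (l, j) is the one numbered
   [mxvec_index l j], so that block l of Y is the l-th row of an m x M array.
   Indices 1..m and 1..M become 'I_m and 'I_M, i.e. start at 0. *)
Definition coord (R : realType) (m M : nat) (Y : 'cV[R]_(m * M))
    (l : 'I_m) (j : 'I_M) : R :=
  Y (mxvec_index l j) 0.

Definition vec_of (R : realType) (m M : nat) (F : 'I_m -> 'I_M -> R) :
    'cV[R]_(m * M) :=
  (mxvec (\matrix_(l, j) F l j))^T.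

Lemma coord_vec_of (R : realType) (m M : nat) (F : 'I_m -> 'I_M -> R) l j :
  coord (vec_of F) l j = F l j.
Proof. by rewrite /coord /vec_of mxE mxvecE mxE. Qed.

Definition partial (R : realType) (n : nat) (H : 'cV[R]_n -> R) (k : 'I_n)
    (Y : 'cV[R]_n) : R :=
  'D_(delta_mx k 0) H Y.

Definition gradient (R : realType) (n : nat) (H : 'cV[R]_n -> R)
    (Y : 'cV[R]_n) : 'cV[R]_n :=
  \col_k partial H k Y.

Definition continuously_differentiable (R : realType) (n : nat)
    (H : 'cV[R]_n -> R) : Prop :=
  (forall Y : 'cV[R]_n, differentiable H Y) /\ continuous (gradient H).

Definition skew_symmetric (R : realType) (n : nat) (J : 'M[R]_n) : Prop :=
  J^T = - J.

(* W^{a,i}(theta) *)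
Definition dp_path (R : realType) (m M : nat) (pi : 'S_m) (sigma : 'S_M)
    (Yhat Y : 'cV[R]_(m * M)) (a : 'I_m) (i : 'I_M) (theta : R) :
    'cV[R]_(m * M) :=
  vec_of (fun l j =>
    if ((pi^-1)%g l < a)%N || ((l == pi a) && ((sigma^-1)%g j < i)%N)
    then coord Yhat l j
    else if (l == pi a) && (j == sigma i)
    then theta * coord Yhat l j + (1 - theta) * coord Y l j
    else coord Y l j).

(* The component (l, j) is computed with a = pi^-1 l and i = sigma^-1 j;
   see [coord_dp_gradient] for the component (pi a, sigma i). *)
Definition dp_gradient (R : realType) (m M : nat) (pi : 'S_m) (sigma : 'S_M)
    (H : 'cV[R]_(m * M) -> R) (Yhat Y : 'cV[R]_(m * M)) : 'cV[R]_(m * M) :=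
  vec_of (fun l j =>
    \int[lebesgue_measure]_(theta in `[0, 1])
      partial H (mxvec_index l j)
        (dp_path pi sigma Yhat Y ((pi^-1)%g l) ((sigma^-1)%g j) theta)).

Lemma coord_dp_gradient (R : realType) (m M : nat) (pi : 'S_m) (sigma : 'S_M)
    (H : 'cV[R]_(m * M) -> R) (Yhat Y : 'cV[R]_(m * M)) (a : 'I_m) (i : 'I_M) :
  coord (dp_gradient pi sigma H Yhat Y) (pi a) (sigma i) =
  \int[lebesgue_measure]_(theta in `[0, 1])
    partial H (mxvec_index (pi a) (sigma i))
      (dp_path pi sigma Yhat Y a i theta).
Proof. by rewrite coord_vec_of !permK. Qed.

(* One step Y |-> Yhat of the DP-AVF method for Y' = J (gradient H Y). *)
Definition dp_avf_step (R : realType) (m M : nat) (pi : 'S_m) (sigma : 'S_M)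
    (J : 'M[R]_(m * M)) (H : 'cV[R]_(m * M) -> R) (tau : R)
    (Y Yhat : 'cV[R]_(m * M)) : Prop :=
  tau^-1 *: (Yhat - Y) = J *m dp_gradient pi sigma H Yhat Y.

(* Main.v *)
Require Import Defs.
From mathcomp Require Import all_boot all_order all_algebra all_fingroup.
From mathcomp Require Import all_classical all_reals all_analysis.
From mathcomp Require Import zify ring.

Set Implicit Arguments.
Unset Strict Implicit.
Unset Printing Implicit Defensive.

Import Order.TTheory GRing.Theory Num.Theory.
Import numFieldNormedType.Exports.
(* From here on [coord] is the entry of an m x M array, not [vector.coord]. *)
Import Defs.
Local Open Scope ring_scope.

(** The method is a discrete gradient method.  The heart of the matter is the
    identity [dp_gradient_discrete]: the averaged gradient g satisfies
    [sum_k g_k (Yhat - Y)_k = H Yhat - H Y].  The paths W^{a,i}, taken in the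
    lexicographic order of (a, i), join end to end into a polygonal path from Y
    to Yhat whose (a, i)-th edge moves only the coordinate (pi a, sigma i), by
    the full increment of that coordinate.  By the fundamental theorem of
    calculus along that edge ([coordinate_FTC]), the (pi a, sigma i) term of
    the sum is the variation of H along the edge, and the sum telescopes.

    For a step of the method, Yhat - Y = tau J g, so that the sum is also
    [tau (g^T J g)], which vanishes because J is skew-symmetric
    ([skew_symmetric_quad]). *)

Lemma skew_symmetric_quad (R : realType) (n : nat) (J : 'M[R]_n) (g : 'cV[R]_n) :
  skew_symmetric J -> \sum_k g k 0 * (J *m g) k 0 = 0.
Proof.
move=> J_skew.
have -> : \sum_k g k 0 * (J *m g) k 0 = (g^T *m (J *m g)) 0 0.
  by rewrite [RHS]mxE; apply: eq_bigr => k _; rewrite [g^T _ _]mxE.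
set q := _ *m _.
have qN : q^T = - q.
  by rewrite /q !trmx_mul trmxK J_skew mulmxN mulNmx mulmxA.
(* a 1 x 1 matrix is its own transpose *)
have /eqP : q 0 0 = - q 0 0 by rewrite -[in LHS](trmxK q) qN !mxE.
by rewrite -addr_eq0 -mulr2n mulrn_eq0 => /eqP.
Qed.

Lemma is_diff_line (R : realType) (V : normedModType R) (A v : V) (t : R) :
  is_diff t (fun s : R => A + s *: v) (fun s : R => s *: v).
Proof.
have -> : (fun s : R => s *: v) = (fun s : R => (cst 0 + ( *:%R^~ v)) s).
  by apply/funext => s; rewrite fctE add0r.
exact: is_diffD.
Qed.

(** The fundamental theorem of calculus for H along the segment from A to
    A + c e_k; it also holds for c = 0. *)
Lemma coordinate_FTC (R : realType) (n : nat) (H : 'cV[R]_n -> R)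
    (k : 'I_n) (A : 'cV[R]_n) (c : R) :
  continuously_differentiable H ->
  c * \int[lebesgue_measure]_(theta in `[0, 1]%classic)
        partial H k (A + (theta * c) *: delta_mx k 0) =
  H (A + c *: delta_mx k 0) - H A.
Proof.
move=> [dH cgH].
pose W (theta : R) : 'cV[R]_n := A + (theta * c) *: delta_mx k 0.
have dW (t : R) : is_diff t W (fun s => s *: (c *: delta_mx k 0)).
  rewrite (_ : W = fun s => A + s *: (c *: delta_mx k 0)).
    exact: is_diff_line.
  by apply/funext => s; rewrite /W scalerA.
have cW : continuous W by move=> t; apply: differentiable_continuous.
have cf : continuous (fun t => partial H k (W t)).
  move=> t.
  have -> : (fun t => partial H k (W t)) =
            (fun B : 'cV[R]_n => B k 0) \o (gradient H \o W).
    by apply/funext => s; rewrite /= mxE.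
  apply: continuous_comp; last exact: coord_continuous.
  by apply: continuous_comp; [exact: cW | exact: cgH].
have dHW (t : R) : differentiable (H \o W) t.
  exact: differentiable_comp.
have cHW : continuous (H \o W).
  by move=> t; apply: differentiable_continuous.
rewrite -RintegralZl //; last first.
  apply: continuous_compact_integrable; first exact: segment_compact.
  exact: continuous_subspaceT.
rewrite /Rintegral (@continuous_FTC2 _ _ (H \o W)) //=.
- by rewrite /W mul1r mul0r scale0r addr0.
- apply: continuous_subspaceT => t.
  by apply: cvgM; [exact: cvg_cst | exact: cf].
- split=> [t _||].
  + exact/derivable1_diffP.
  + exact/cvg_at_right_filter/cHW.
  + exact/cvg_at_left_filter/cHW.
- move=> t _; rewrite derive1E' // diff_comp //= diff_val scale1r linearZ /=.
  by rewrite /partial deriveE.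
Qed.

(** The vertex number n, 0 <= n <= m M, of the polygonal path from Y to Yhat:
    the first n coordinates have been updated, the coordinate (pi a, sigma i)
    being number a M + i in the order of updating. *)
Definition dp_node (R : realType) (m M : nat) (pi : 'S_m) (sigma : 'S_M)
    (Yhat Y : 'cV[R]_(m * M)) (n : nat) : 'cV[R]_(m * M) :=
  vec_of (fun l j => if ((pi^-1)%g l * M + (sigma^-1)%g j < n)%N
                     then coord Yhat l j else coord Y l j).

Lemma coord_inj (R : realType) (m M : nat) (Y Z : 'cV[R]_(m * M)) :
  (forall l j, coord Y l j = coord Z l j) -> Y = Z.
Proof. by move=> YZ; apply/colP; case/mxvec_indexP=> l j; apply: YZ. Qed.

Lemma coord_delta (R : realType) (m M : nat) (l l' : 'I_m) (j j' : 'I_M) :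
  coord (delta_mx (mxvec_index l j) 0 : 'cV[R]_(m * M)) l' j' =
  ((l' == l) && (j' == j))%:R.
Proof. by rewrite /coord -trmx_delta -mxvec_delta mxE mxvecE mxE. Qed.

Lemma coordD (R : realType) (m M : nat) (Y Z : 'cV[R]_(m * M)) l j :
  coord (Y + Z) l j = coord Y l j + coord Z l j.
Proof. exact: mxE. Qed.

Lemma coordZ (R : realType) (m M : nat) (c : R) (Y : 'cV[R]_(m * M)) l j :
  coord (c *: Y) l j = c * coord Y l j.
Proof. exact: mxE. Qed.

Lemma ltn_lex (M a a' i i' : nat) : (i < M)%N -> (i' < M)%N ->
  (a' * M + i' < a * M + i)%N = (a' < a)%N || ((a' == a) && (i' < i)%N).
Proof.
move=> iM i'M; case: (ltngtP a' a) => [lt_a|gt_a|->] /=; first nia; first nia.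
by rewrite ltn_add2l.
Qed.

Lemma eqn_lex (M a a' i i' : nat) : (i < M)%N -> (i' < M)%N ->
  (a' * M + i' == a * M + i)%N = (a' == a) && (i' == i).
Proof.
move=> iM i'M; case: (ltngtP a' a) => [lt_a|gt_a|->] /=; last by rewrite eqn_add2l.
  by apply/ltn_eqF; rewrite ltn_lex // lt_a.
by apply/gtn_eqF; rewrite ltn_lex // gt_a.
Qed.

Lemma sum_mxvec_index (V : nmodType) (m M : nat) (F : 'I_(m * M) -> V) :
  \sum_k F k = \sum_l \sum_j F (mxvec_index l j).
Proof.
rewrite pair_bigA (reindex _ (curry_mxvec_bij _ _)) /=.
by apply: eq_bigr => -[l j].
Qed.

Section DualPartition.
Variables (R : realType) (m M : nat) (pi : 'S_m) (sigma : 'S_M).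
Variables (Yhat Y : 'cV[R]_(m * M)).

Let node := dp_node pi sigma Yhat Y.
Let incr l j : R := coord Yhat l j - coord Y l j.
Let basis l j : 'cV[R]_(m * M) := delta_mx (mxvec_index l j) 0.

(** W^{a,i} starts at the vertex number a M + i and runs along the edge that
    updates the coordinate (pi a, sigma i); by [dp_nodeS] it ends at the next
    vertex. *)
Lemma dp_path_node (a : 'I_m) (i : 'I_M) (theta : R) :
  dp_path pi sigma Yhat Y a i theta =
  node (a * M + i) +
  (theta * incr (pi a) (sigma i)) *: basis (pi a) (sigma i).
Proof.
apply: coord_inj => l j; rewrite coordD coordZ coord_delta !coord_vec_of.
(* name the ranks b and k of l and j in the orders pi and sigma *)
rewrite ltn_lex // -[l](permKV pi) -[j](permKV sigma) !permK.
move: (_ l) (_ j) => b k; rewrite !(inj_eq perm_inj) -val_eqE -[k == i]val_eqE.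
case: (ltngtP b a) => [_|_|/val_inj ->] /=; try by rewrite mulr0 addr0.
case: (ltngtP k i) => [_|_|/val_inj ->] /=; try by rewrite mulr0 addr0.
by rewrite /incr; ring.
Qed.

Lemma dp_nodeS (a : 'I_m) (i : 'I_M) :
  node (a * M + i).+1 =
  node (a * M + i) + incr (pi a) (sigma i) *: basis (pi a) (sigma i).
Proof.
apply: coord_inj => l j; rewrite coordD coordZ coord_delta !coord_vec_of.
(* name the ranks b and k of l and j in the orders pi and sigma *)
rewrite ltnS leq_eqVlt ltn_lex // -[l](permKV pi) -[j](permKV sigma) !permK.
move: (_ l) (_ j) => b k; rewrite !(inj_eq perm_inj).
have -> : (b * M + k == a * M + i)%N = (b == a) && (k == i).
  exact: eqn_lex.
rewrite -!val_eqE /=.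
case: (ltngtP b a) => [_|_|/val_inj ->] /=; try by rewrite mulr0 addr0.
case: (ltngtP k i) => [_|_|/val_inj ->] /=; try by rewrite mulr0 addr0.
by rewrite /incr; ring.
Qed.

(** The discrete gradient property. *)
Lemma dp_gradient_discrete (H : 'cV[R]_(m * M) -> R) :
  continuously_differentiable H ->
  \sum_k dp_gradient pi sigma H Yhat Y k 0 * (Yhat - Y) k 0 = H Yhat - H Y.
Proof.
move=> H_C1; set g := dp_gradient _ _ _ _ _.
rewrite sum_mxvec_index (reindex_inj (@perm_inj _ pi)) /=.
have row_sum (a : 'I_m) :
    \sum_j coord g (pi a) j * coord (Yhat - Y) (pi a) j =
    H (node (a.+1 * M)) - H (node (a * M)).
  rewrite (reindex_inj (@perm_inj _ sigma)) /=.
  pose h i := H (node (a * M + i)).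
  have -> : H (node (a.+1 * M)) = h M by rewrite /h -mulSnr.
  have -> : H (node (a * M)) = h 0%N by rewrite /h addn0.
  rewrite -(telescope_sumr h (leq0n M)) big_mkord; apply: eq_bigr => i _.
  rewrite coord_dp_gradient /h addnS dp_nodeS -coordinate_FTC //.
  have -> : coord (Yhat - Y) (pi a) (sigma i) = incr (pi a) (sigma i).
    by rewrite coordD [coord (- Y) _ _]mxE.
  under eq_Rintegral => theta _ do rewrite dp_path_node.
  exact: mulrC.
rewrite (eq_bigr _ (fun a _ => row_sum a)).
rewrite -(big_mkord xpredT (fun a => H (node (a.+1 * M)) - H (node (a * M)))).
rewrite (telescope_sumr (fun a => H (node (a * M)))) //.
congr (H _ - H _); apply: coord_inj => l j; rewrite coord_vec_of ?ltn0 //.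
(* every coordinate has a number below m M *)
rewrite ifT //.
have := ltn_ord ((pi^-1)%g l); have := ltn_ord ((sigma^-1)%g j); nia.
Qed.

End DualPartition.

Theorem theorem3p1 (R : realType) (m M : nat) (m_ge1 : (1 <= m)%N)
    (M_ge1 : (1 <= M)%N) (H : 'cV[R]_(m * M) -> R)
    (H_C1 : continuously_differentiable H)
    (J : 'M[R]_(m * M)) (J_skew : skew_symmetric J)
    (tau : R) (tau_gt0 : 0 < tau) (pi : 'S_m) (sigma : 'S_M)
    (Y Yhat : 'cV[R]_(m * M))
    (step : dp_avf_step pi sigma J H tau Y Yhat) :
  H Yhat = H Y.
Proof.
apply/eqP; rewrite -subr_eq0 -(dp_gradient_discrete pi sigma) //.
have -> : Yhat - Y = tau *: (J *m dp_gradient pi sigma H Yhat Y).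
  by rewrite -step scalerA divff ?scale1r // gt_eqF.
apply/eqP; under eq_bigr do rewrite [(tau *: (J *m _)) _ _]mxE mulrCA.
by rewrite -mulr_sumr skew_symmetric_quad // mulr0.
Qed.
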